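(* Let $t\ge 2$ be an integer and let $A,d$ be integers with $A\ge 0$ and $d\ge A+1$. Then $$\sum_{a=0}^A \sum_{i=0}^{d-a} \;\sum_{\substack{i_1+\cdots+i_{t-1}=i\\ i_1,\ldots,i_{t-1}\geq 0}} \binom{d}{a+i}\binom{a+i}{a,i_1,\ldots,i_{t-1}} \binom{t}{1}^{i_1}\binom{t}{2}^{i_2}\cdots\binom{t}{t-1}^{i_{t-1}} \bigl(ta+i_1+2i_2+\cdots+(t-1)i_{t-1}\bigr)!\,\bigl(td-ta-i_1-2i_2-\cdots-(t-1)i_{t-1}\bigr)!$$ $$=\;(td+1)!\,\bigl(1+(tA+t)^{-1}\bigr)^{-1}\,\frac{\binom{d}{A+1}}{\binom{d+1/t}{d-A-1}}.$$
   Context: The innermost sum is over tuples of nonnegative integers $(i_1,\ldots,i_{t-1})$ with sum $i$. $\binom{a+i}{a,i_1,\ldots,i_{t-1}}=\frac{(a+i)!}{a!\,i_1!\cdots i_{t-1}!}$ is the multinomial coefficient. For integers $d,b\ge 0$ the fractional binomial coefficient is $$\binom{d+1/t}{b} := \frac{(td+1)(t(d-1)+1)\cdots(t(d-b+1)+1)}{b!\,t^b},$$ with value $1$ when $b=0$. *)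

(* Defs.v *)
From mathcomp Require Import all_boot all_order all_algebra.

Set Implicit Arguments.
Unset Strict Implicit.
Unset Printing Implicit Defensive.

Import GRing.Theory.
Local Open Scope ring_scope.

(* binom(d + 1/t, b). The difference d - j is taken in rat, so that the factors
   are not truncated when b > d. *)
Definition frac_binom (t d b : nat) : rat :=
  (\prod_(j < b) (t%:R * (d%:R - j%:R) + 1)) / (b`!%:R * t%:R ^+ b).

(* A tuple (i_1, ..., i_n) of nonnegative integers with sum i is a finite
   function k with i_(j+1) = k j for j = 0, ..., n - 1; its entries are at most
   i, hence the finite codomain 'I_i.+1. *)
Definition idx_tuple (n i : nat) := {ffun 'I_n -> 'I_i.+1}.

Definition has_sum (n i : nat) (k : idx_tuple n i) : bool :=
  (\sum_(j < n) k j == i)%N.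

(* i_1 + 2 i_2 + ... + n i_n *)
Definition weight (n i : nat) (k : idx_tuple n i) : nat :=
  (\sum_(j < n) j.+1 * k j)%N.

(* The multinomial coefficient binom(a + i; a, i_1, ..., i_n), for k of sum i. *)
Definition multinomial (a n i : nat) (k : idx_tuple n i) : rat :=
  (a + i)`!%:R / (a`!%:R * \prod_(j < n) (k j)`!%:R).

(* Main.v *)
Require Import Defs.
From HB Require Import structures.
From mathcomp Require Import all_boot all_order all_algebra.
From mathcomp Require Import ring zify.

Set Implicit Arguments.
Unset Strict Implicit.
Unset Printing Implicit Defensive.

Import GRing.Theory Num.Theory.
Local Open Scope ring_scope.

(** Read the sum as a count of subsets of a grid with [d] columns of [t] cells:
    the term for [a], [i] and [k] counts the subsets with exactly [a] full
    columns and [k j] columns containing [j + 1] cells, each subset of size [w]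
    having weight [w! (td - w)!].

    By Euler's Beta integral this weight is [(td + 1)!] times the integral over
    [[0, 1]] of [x^w (1 - x)^(td - w)].  Under the integral sign the cells are
    independent, each chosen with probability [x]; so a column is full with
    probability [x^t], and exactly [a] columns are full with probability
    [C(d, a) x^(ta) (1 - x^t)^(d - a)].  This is [sum_exactly_full]; the passage
    under the integral sign is the polynomial identity
    [expn_one_sub_Xn_Bernstein], that is, the multinomial theorem applied to
    [1 - x^t = sum_(j < t) C(t, j) x^j (1 - x)^(t - j)].

    The integral [J_a] of this probability ([full_integral]) is again a Beta
    integral, computed in [poly_integral_Beta].  Its closed form gives
    [(ta + 1) J_a = t (a + 1) J_(a + 1)], which makes the partial sums collapse:
    [J_0 + ... + J_A = t (A + 1) J_(A + 1)] ([sum_full_integral]).  The right-hand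
    side of the theorem is [(td + 1)! t (A + 1) J_(A + 1)] with the product in
    [J_(A + 1)] expressed by the fractional binomial coefficient.

    Only polynomials are integrated, so the integral is taken formally, as a
    linear form on polynomials over the rationals. *)

(** * The integral of a polynomial over the unit interval *)

Lemma fact_neq0 (n : nat) : n`!%:R != 0 :> rat.
Proof. by rewrite pnatr_eq0 -lt0n fact_gt0. Qed.

Definition poly_integral (p : {poly rat}) : rat :=
  \sum_(i < size p) p`_i / i.+1%:R.

(** The sum may run over any bound on the size, so that polynomials of different
    sizes can be compared. *)
Lemma poly_integral_widen (N : nat) (p : {poly rat}) :
  (size p <= N)%N -> poly_integral p = \sum_(i < N) p`_i / i.+1%:R.
Proof.
move=> leN; rewrite /poly_integral (big_ord_widen N (fun i => p`_i / i.+1%:R)) //.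
rewrite big_mkcond /=; apply: eq_bigr => i _.
by case: ltnP => // le_pi; rewrite nth_default // mul0r.
Qed.

Lemma poly_integral_is_linear : linear_for *%R poly_integral.
Proof.
move=> c p q; pose N := maxn (size p) (maxn (size q) (size (c *: p + q)%R)).
have [ps qs rs] : [/\ size p <= N, size q <= N & size (c *: p + q)%R <= N]%N.
  by rewrite /N !leq_max !leqnn !orbT.
rewrite (poly_integral_widen ps) (poly_integral_widen qs) (poly_integral_widen rs).
rewrite mulr_sumr -big_split /=; apply: eq_bigr => i _.
by rewrite coefD coefZ mulrDl mulrA.
Qed.

HB.instance Definition _ :=
  GRing.isLinear.Build rat {poly rat} rat _ poly_integral poly_integral_is_linear.

Lemma poly_integralXn (n : nat) : poly_integral 'X^n = n.+1%:R^-1.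
Proof.
rewrite /poly_integral size_polyXn big_ord_recr /= coefXn eqxx mul1r.
rewrite big1 ?add0r // => i _.
by rewrite coefXn ltn_eqF ?mul0r.
Qed.

Lemma prod_progression_neq0 (t s m n : nat) :
  \prod_(m <= j < n) (s + t * j).+1%:R != 0 :> rat.
Proof. by rewrite prodf_seq_neq0; apply/allP => j _; rewrite pnatr_eq0. Qed.

(** Both sides satisfy [F s (b + 1) = F s b - F (s + t) b], the left one since
    [X^s (1 - X^t)^(b + 1) = X^s (1 - X^t)^b - X^(s + t) (1 - X^t)^b].  Up to the
    substitution [u = x^t] this is the Beta integral at [(s + 1) / t] and
    [b + 1]. *)
Lemma poly_integral_Beta (t s b : nat) :
  poly_integral ('X^s * (1 - 'X^t) ^+ b)
  = b`!%:R * t%:R ^+ b / \prod_(0 <= j < b.+1) (s + t * j).+1%:R.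
Proof.
elim: b s => [|b IHb] s.
  by rewrite expr0 mulr1 big_nat1 muln0 addn0 poly_integralXn expr0 mulr1 mul1r.
have -> : 'X^s * (1 - 'X^t) ^+ b.+1
    = 'X^s * (1 - 'X^t) ^+ b - 'X^(s + t) * (1 - 'X^t) ^+ b :> {poly rat}.
  by rewrite exprD exprS; ring.
rewrite raddfB /= !IHb.
(* The products for [s] and [s + t] both contain the factors 1 to [b] of the
   product for [s] and [b + 1]; they lack its last, respectively first, one. *)
have shift n : \prod_(0 <= j < n) (s + t + t * j).+1%:R
    = \prod_(1 <= j < n.+1) (s + t * j).+1%:R :> rat.
  by rewrite big_add1 /=; apply: eq_bigr => j _; rewrite mulnS addnA.
rewrite shift !(big_ltn (m := 0)) // (big_nat_recr b.+1) //=.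
have := prod_progression_neq0 t s 1 b.+1.
set P := \prod_(1 <= j < b.+1) _ => P0.
rewrite factS exprS !mulnS muln0 addn0 !natrM.
rewrite -!natr1 !natrD !natrM.
have s1 : s%:R + 1 != 0 :> rat by rewrite natr1 pnatr_eq0.
have s2 : s%:R + (t%:R + t%:R * b%:R) + 1 != 0 :> rat.
  by rewrite -natrM -!natrD natr1 pnatr_eq0.
by field; rewrite P0 s1 s2.
Qed.

Lemma poly_integral_Bernstein (w m : nat) :
  poly_integral ('X^w * (1 - 'X) ^+ m) = w`!%:R * m`!%:R / (w + m).+1`!%:R.
Proof.
rewrite -[X in 1 - X]expr1 poly_integral_Beta expr1n mulr1.
have -> : \prod_(0 <= j < m.+1) (w + 1 * j).+1%:R = (w + m).+1`!%:R / w`!%:R :> rat.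
  elim: m => [|m IHm]; last first.
    by rewrite big_nat_recr //= IHm addnS [in RHS]factS natrM mul1n addnS; ring.
  by rewrite big_nat1 addn0 factS natrM mulfK // fact_neq0.
by rewrite invf_div mulrA [_%:R * w`!%:R]mulrC.
Qed.

(** * The multinomial theorem *)

(** The binomial theorem, written as the functional equation of the exponential
    series in degree [r]. *)
Lemma sum_div_fact (R : comAlgType rat) (x y : R) (r : nat) :
  \sum_(m < r.+1) (m`!%:R^-1 *: x ^+ m) * ((r - m)`!%:R^-1 *: y ^+ (r - m))
  = r`!%:R^-1 *: (x + y) ^+ r.
Proof.
rewrite addrC exprDn scaler_sumr; apply: eq_bigr => m _.
rewrite -scalerAl -scalerAr scalerA -scaler_nat scalerA [x ^+ m * _]mulrC.
have lemr : (m <= r)%N by rewrite -ltnS.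
congr (_ *: _); rewrite -(bin_fact lemr) !natrM.
have bin0 : 'C(r, m)%:R != 0 :> rat by rewrite pnatr_eq0 -lt0n bin_gt0.
by field; rewrite !fact_neq0 bin0.
Qed.

(** The product of the series [exp (y_j Z)] is [exp ((sum_j y_j) Z)].  Truncating
    the series after degree [N] does not affect the coefficients up to [N]. *)
Lemma coef_prod_exp (R : comAlgType rat) (n N r : nat) (y : 'I_n -> R) : (r <= N)%N ->
  (\prod_(j < n) \poly_(m < N.+1) (m`!%:R^-1 *: y j ^+ m))`_r
  = r`!%:R^-1 *: (\sum_(j < n) y j) ^+ r.
Proof.
elim/big_rec2: _ r => [|j P S _ IH] r le_rN.
  by rewrite coef1; case: r le_rN => [|r] _; rewrite ?expr0n ?scaler0 // invr1 scale1r.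
rewrite coefM -sum_div_fact; apply: eq_bigr => m _.
have le_mr : (m <= r)%N by rewrite -ltnS.
rewrite coef_poly ltnS (leq_trans le_mr le_rN) IH //.
exact: leq_trans (leq_subr _ _) le_rN.
Qed.

(** Take the coefficient of degree [i] in [coef_prod_exp] with [N = i].
    Distributing the product of the truncated series over their terms yields a
    sum over all finite functions from ['I_n] to ['I_i.+1], and the coefficient
    extraction keeps those of sum [i]. *)
Lemma multinomial_expn (R : comAlgType rat) (n i : nat) (y : 'I_n -> R) :
  (\sum_(j < n) y j) ^+ i
  = \sum_(k : idx_tuple n i | has_sum k)
      (i`!%:R / \prod_(j < n) (k j)`!%:R) *: \prod_(j < n) y j ^+ k j.
Proof.
rewrite -[LHS]scale1r -[X in X *: _ = _](divff (fact_neq0 i)) -scalerA.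
rewrite -(coef_prod_exp y (leqnn i)).
under eq_bigr do rewrite poly_def.
rewrite bigA_distr_bigA coef_sum scaler_sumr [RHS]big_mkcond /=.
apply: eq_bigr => k _.
under eq_bigr do rewrite -mul_polyC.
rewrite big_split /= prodrXr -rmorph_prod /= coefCM coefXn eq_sym /has_sum.
case: eqP => _; last by rewrite mulr0 scaler0.
by rewrite mulr1 scaler_prod scalerA prodfV.
Qed.

(** * Expansion over the filling of the columns *)

(** Expand [1 = ((1 - X) + X)^(n + 1)] and remove the last term: a column that is
    not full is empty or has [j + 1 <= n] chosen cells. *)
Lemma one_sub_Xn_Bernstein (n : nat) :
  1 - 'X^(n.+1) = (1 - 'X) ^+ n.+1
    + \sum_(j < n) 'C(n.+1, j.+1)%:R *: ('X^(j.+1) * (1 - 'X) ^+ (n - j)) :> {poly rat}.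
Proof.
have := exprDn (1 - 'X : {poly rat}) 'X n.+1.
rewrite subrK expr1n big_ord_recl big_ord_recr /= bin0 binn subnn subn0 !expr0.
rewrite mulr1 mul1r !mulr1n => {1}->; rewrite addrA addrK; congr (_ + _).
by apply: eq_bigr => j _; rewrite subSS scaler_nat mulrC.
Qed.

Lemma weight_le (n i : nat) (k : idx_tuple n i) :
  has_sum k -> (weight k <= n.+1 * i)%N.
Proof.
move=> /eqP sk; rewrite -[X in (_ <= _ * X)%N]sk big_distrr /=.
by apply: leq_sum => j _; rewrite leq_mul2r ltnW ?orbT // ltnS.
Qed.

(** Among [b] columns, none of them full, choose the [i] that are nonempty
    (binomial theorem), then distribute the sizes [j + 1] among these (multinomial
    theorem). *)
Lemma expn_one_sub_Xn_Bernstein (n b : nat) :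
  (1 - 'X^(n.+1)) ^+ b
  = \sum_(i < b.+1) \sum_(k : idx_tuple n i | has_sum k)
      ('C(b, i)%:R * (i`!%:R / \prod_(j < n) (k j)`!%:R)
        * \prod_(j < n) 'C(n.+1, j.+1)%:R ^+ k j)
      *: ('X^(weight k) * (1 - 'X) ^+ (n.+1 * b - weight k)) :> {poly rat}.
Proof.
rewrite one_sub_Xn_Bernstein exprDn; apply: eq_bigr => i _.
rewrite multinomial_expn mulr_sumr -sumrMnl; apply: eq_bigr => k sk.
have le_ib : (i <= b)%N by rewrite -ltnS.
have pow (j : 'I_n) : ('C(n.+1, j.+1)%:R *: ('X^(j.+1) * (1 - 'X) ^+ (n - j))) ^+ k j
    = 'C(n.+1, j.+1)%:R ^+ k j *: ('X^(j.+1 * k j) * (1 - 'X) ^+ ((n - j) * k j))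
    :> {poly rat}.
  by rewrite exprZn exprMn !exprM.
rewrite (eq_bigr _ (fun j _ => pow j)) scaler_prod big_split /= !prodrXr.
rewrite -/(weight k).
have le_w := weight_le sk.
have -> : (\sum_(j < n) (n - j) * k j = n.+1 * i - weight k)%N.
  apply/eqP; rewrite -(eqn_add2r (weight k)) subnK // /weight -big_split /=.
  rewrite -[X in _ == (_ * X)%N](eqP sk) big_distrr /=; apply/eqP/eq_bigr => j _.
  by rewrite -mulnDl addnS subnK // ltnW.
rewrite -scalerAr -scalerAr -scaler_nat !scalerA mulrA [_ ^+ (b - i) * _]mulrCA.
rewrite -exprM -exprD.
congr (_ *: ('X^_ * (1 - 'X) ^+ _)).
by rewrite addnBA // -mulnDr subnK.
Qed.

(** Choosing the [a] full columns first turns the sum over [i] and [k] into the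
    expansion of a [(d - a)]-th power. *)
Lemma bin_mul_multinomial (d a n i : nat) (k : idx_tuple n i) :
  (a + i <= d)%N ->
  'C(d, a + i)%:R * multinomial a k
  = 'C(d, a)%:R * ('C(d - a, i)%:R * (i`!%:R / \prod_(j < n) (k j)`!%:R)).
Proof.
move=> le_aid.
have le_ad : (a <= d)%N := leq_trans (leq_addr _ _) le_aid.
have le_i : (i <= d - a)%N by rewrite leq_subRL.
have binE m p : (p <= m)%N -> 'C(m, p)%:R = m`!%:R / (p`!%:R * (m - p)`!%:R) :> rat.
  by move=> le_pm; rewrite -(bin_fact le_pm) !natrM mulfK // mulf_neq0 ?fact_neq0.
rewrite !binE // -subnDA /multinomial.
have : \prod_(j < n) (k j)`!%:R != 0 :> rat
  by apply/prodf_neq0 => j _; apply: fact_neq0.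
by set P := \prod_(j < n) _ => P0; field; rewrite P0 !fact_neq0.
Qed.

(** By [poly_integral_Bernstein] the factor [w! (td - w)!] is [(td + 1)!] times the
    integral of [X^w (1 - X)^(td - w)]; by linearity the sum moves under the
    integral, where it is the expansion of [(1 - X^t)^(d - a)]. *)
Lemma sum_exactly_full (n d a : nat) : (a <= d)%N ->
  \sum_(0 <= i < (d - a).+1)
    \sum_(k : idx_tuple n i | has_sum k)
      ('C(d, a + i)%:R * multinomial a k
       * (\prod_(j < n) 'C(n.+1, j.+1)%:R ^+ k j)
       * (n.+1 * a + weight k)`!%:R * (n.+1 * d - n.+1 * a - weight k)`!%:R)
  = (n.+1 * d + 1)`!%:R
    * ('C(d, a)%:R * poly_integral ('X^(n.+1 * a) * (1 - 'X^(n.+1)) ^+ (d - a))).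
Proof.
move=> le_ad; rewrite expn_one_sub_Xn_Bernstein.
rewrite ['X^_ * _]mulr_sumr raddf_sum 2!mulr_sumr /=.
rewrite big_mkord; apply: eq_bigr => i _.
rewrite ['X^_ * _]mulr_sumr raddf_sum 2!mulr_sumr /=; apply: eq_bigr => k sk.
have le_i : (i <= d - a)%N by rewrite -ltnS.
have le_w : (weight k <= n.+1 * (d - a))%N.
  by rewrite (leq_trans (weight_le sk)) // leq_mul2l le_i orbT.
rewrite bin_mul_multinomial; last by rewrite -leq_subRL.
rewrite -scalerAr linearZ /= ['X^(n.+1 * a) * _]mulrA -exprD.
rewrite poly_integral_Bernstein -mulnBr.
rewrite -addnA subnKC // -mulnDr subnKC // addn1.
set c := (_ / _ : rat); set P := \prod_(j < n) _.
by field; rewrite fact_neq0.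
Qed.

(** * Summation over the number of full columns *)

(** The probability that exactly [a] of the [d] columns are full when the cells are
    chosen independently with a uniformly distributed random probability. *)
Definition full_integral (t d a : nat) : rat :=
  'C(d, a)%:R * poly_integral ('X^(t * a) * (1 - 'X^t) ^+ (d - a)).

Lemma full_integralE (t d a : nat) : (a <= d)%N ->
  full_integral t d a
  = 'C(d, a)%:R * ((d - a)`!%:R * t%:R ^+ (d - a))
    / \prod_(a <= k < d.+1) (t * k).+1%:R.
Proof.
move=> le_ad; rewrite /full_integral poly_integral_Beta -[RHS]mulrA.
congr (_ * (_ / _)).
rewrite [RHS](big_addn 0 _ a) subSn //; apply: eq_bigr => j _.
by rewrite mulnDr addnC.
Qed.

(** Passing from [a] to [a + 1] removes the factor [ta + 1] from the denominator
    and [t (d - a)] from the numerator, and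
    [(a + 1) C(d, a + 1) = (d - a) C(d, a)]. *)
Lemma full_integral_succ (t d a : nat) : (a < d)%N ->
  (t * a).+1%:R * full_integral t d a
  = (t * a.+1)%:R * full_integral t d a.+1.
Proof.
move=> lt_ad; have le_ad := ltnW lt_ad.
rewrite !full_integralE // [in LHS](big_ltn (n := d.+1)) ?ltnS //.
have := prod_progression_neq0 t 0 a.+1 d.+1.
under eq_bigr do rewrite add0n.
set P := \prod_(a.+1 <= k < d.+1) _ => P0.
have a1 : 1 + t%:R * a%:R != 0 :> rat by rewrite -natrM nat1r pnatr_eq0.
have binS : a.+1%:R * 'C(d, a.+1)%:R = (d - a)%:R * 'C(d, a)%:R :> rat.
  by rewrite -!natrM mul_bin_left.
move: binS; rewrite -(subnSK lt_ad) factS exprS !natrM => binS.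
set F := (_`!)%:R; set E := _ ^+ _.
have -> : t%:R * a.+1%:R * ('C(d, a.+1)%:R * (F * E) / P)
    = a.+1%:R * 'C(d, a.+1)%:R * (t%:R * F * E / P) :> rat by ring.
by rewrite binS; field; rewrite P0 a1.
Qed.

(** By induction, the sum up to [A] is [(tA + 1) J_A], to which
    [full_integral_succ] applies. *)
Lemma sum_full_integral (t d A : nat) : (A <= d)%N ->
  \sum_(0 <= a < A) full_integral t d a = (t * A)%:R * full_integral t d A.
Proof.
elim: A => [|A IHA] ltAd; first by rewrite big_nil muln0 mul0r.
rewrite big_nat_recr //= IHA 1?ltnW // -full_integral_succ //.
by rewrite -natr1 mulrDl mul1r.
Qed.

(** The factors of [frac_binom t d (d - A)] decrease from [td + 1] to
    [t (A + 1) + 1]; reversing their order gives a tail of the product in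
    [full_integralE]. *)
Lemma frac_binomE (t d A : nat) : (A <= d)%N ->
  frac_binom t d (d - A)
  = \prod_(A.+1 <= k < d.+1) (t * k).+1%:R / ((d - A)`!%:R * t%:R ^+ (d - A)).
Proof.
move=> leAd; rewrite /frac_binom; congr (_ / _).
rewrite big_nat_rev /= (big_addn 0 _ A.+1) subSS big_mkord.
apply: eq_bigr => j _; rewrite -natr1 natrM -natrB; last first.
  by rewrite ltnW // (leq_trans (ltn_ord j)) // leq_subr.
congr (_ * _%:R + 1); have := ltn_ord j; lia.
Qed.

(* Since a <= A < d and k has sum i <= d - a, the natural-number subtractions
   below are never truncated. *)
Theorem mainTheorem5 (t A d : nat) (ht : (2 <= t)%N) (hd : (A + 1 <= d)%N) :
  \sum_(0 <= a < A.+1) \sum_(0 <= i < (d - a).+1)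
    \sum_(k : idx_tuple (t - 1) i | has_sum k)
      ('C(d, a + i)%:R * multinomial a k
       * (\prod_(j < t - 1) 'C(t, j.+1)%:R ^+ k j)
       * (t * a + weight k)`!%:R * (t * d - t * a - weight k)`!%:R)
  = (t * d + 1)`!%:R * (1 + (t * A + t)%:R^-1)^-1
    * ('C(d, A + 1)%:R / frac_binom t d (d - A - 1)) :> rat.
Proof.
case: t ht => [//|n] hn; rewrite addn1 in hd.
rewrite subn1 /= -[(d - A - 1)%N]subnDA (addn1 A).
transitivity (\sum_(0 <= a < A.+1) (n.+1 * d + 1)`!%:R * full_integral n.+1 d a).
  apply: eq_big_nat => a /= lt_aA; apply: sum_exactly_full.
  by rewrite (leq_trans _ (ltnW hd)) // -ltnS.
rewrite -mulr_sumr sum_full_integral // -[RHS]mulrA; congr (_ * _).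
rewrite frac_binomE // full_integralE // big_ltn //.
have := prod_progression_neq0 n.+1 0 A.+2 d.+1.
under eq_bigr do rewrite add0n.
set P := \prod_(_ <= k < _) _ => P0.
rewrite -mulnSr -[(_ * A.+1).+1%:R]natr1.
have t0 : (n.+1 * A.+1)%:R != 0 :> rat by rewrite pnatr_eq0.
have t1 : (n.+1 * A.+1)%:R + 1 != 0 :> rat by rewrite natr1 pnatr_eq0.
have n0 : n.+1%:R ^+ (d - A.+1) != 0 :> rat by rewrite expf_neq0 // pnatr_eq0.
move: (_ * A.+1)%:R t0 t1 => T t0 t1; move: (_ ^+ _) n0 => E E0.
by field; rewrite t0 t1 E0 fact_neq0 P0.
Qed.
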